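(* Let $(X,d)$ and $(Y,\rho)$ be two metric spaces. Then the following conditions are equivalent. (1) Every quasi-Cauchy Lipschitz function $f:X\to Y$ is Lipschitz in the small. (2) Every real valued quasi-Cauchy Lipschitz function $f$ defined on $X$ is Lipschitz in the small. (3) Every sequence $(x_n)$ in $X$ satisfying $\lim_{n\to\infty}I(x_n)=0$ has a Bourbaki quasi-Cauchy subsequence in $X$.
   Context: For $x\in X$, $I(x)=d(x,X\setminus\{x\})=\inf\{d(x,y):y\in X,\ y\neq x\}$ is the degree of isolation of $x$. A sequence $(x_n)$ in a metric space $(X,d)$ is quasi-Cauchy if for every $\varepsilon>0$ there is $n_0$ such that $d(x_{n+1},x_n)<\varepsilon$ for all $n\ge n_0$. A function $f:(X,d)\to(Y,\rho)$ is quasi-Cauchy Lipschitz if for any quasi-Cauchy sequence $(x_n)$ in $X$ there exists $\lambda>0$ such that $\rho(f(x_k),f(x_{k+1}))\le\lambda d(x_k,x_{k+1})$ for all $k\in\mathbb{N}$. It is Lipschitz in the small if there exist $\delta>0$ and $K>0$ such that $\rho(f(x),f(y))\le Kd(x,y)$ whenever $d(x,y)<\delta$. For $\varepsilon>0$ and $p\in X$, $B^\infty_\varepsilon(p)$ is the set of points $q\in X$ for which there are finitely many points $p=p_0,p_1,\dots,p_n=q$ in $X$ with $d(p_{i-1},p_i)<\varepsilon$ for $i=1,\dots,n$. A sequence $(x_n)$ is Bourbaki quasi-Cauchy in $X$ if for every $\varepsilon>0$ there exist $n_0\in\mathbb{N}$ and $p\in X$ such that $x_n\in B^\infty_\varepsilon(p)$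 for every $n\ge n_0$.
   Formalization: Condition (1) is read as holding for every metric space Y; with Y fixed the equivalence fails, e.g. for Y a single point and X the union of the intervals [4n,4n+1], where (1) holds but (2) and (3) do not. *)

(* Defs.v *)
From HB Require Import structures.
From mathcomp Require Import all_boot all_order all_algebra.
From mathcomp Require Import all_classical all_reals all_analysis.
Set Implicit Arguments.
Unset Strict Implicit.
Unset Printing Implicit Defensive.
Import Order.TTheory GRing.Theory Num.Theory.
Import numFieldNormedType.Exports.
Local Open Scope classical_set_scope.
Local Open Scope ring_scope.

(* The infimum is taken in the extended reals, so that the only point of a
   one-point space has degree of isolation +oo. *)
Definition isolation (R : realType) (X : metricType R) (x : X) : \bar R :=
  ereal_inf [set (mdist x y)%:E | y in ~` [set x]].

Definition quasi_cauchy (R : realType) (X : metricType R) (x : nat -> X) :=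
  forall e : R, 0 < e ->
    exists n0 : nat, forall n, (n0 <= n)%N -> mdist (x n.+1) (x n) < e.

Definition quasi_cauchy_lipschitz (R : realType) (X Y : metricType R)
    (f : X -> Y) :=
  forall x : nat -> X, quasi_cauchy x ->
    exists2 l : R, 0 < l &
      forall k, mdist (f (x k)) (f (x k.+1)) <= l * mdist (x k) (x k.+1).

Definition lipschitz_in_the_small (R : realType) (X Y : metricType R)
    (f : X -> Y) :=
  exists delta K : R, [/\ 0 < delta, 0 < K &
    forall x y, mdist x y < delta -> mdist (f x) (f y) <= K * mdist x y].

(* Only the values p_ 0, ..., p_ n of the sequence p_ matter. *)
Definition chain_ball (R : realType) (X : metricType R) (e : R) (p : X) :
    set X :=
  [set q | exists (n : nat) (p_ : nat -> X), [/\ p_ 0%N = p, p_ n = q &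
    forall i, (i < n)%N -> mdist (p_ i) (p_ i.+1) < e]].

Definition bourbaki_quasi_cauchy (R : realType) (X : metricType R)
    (x : nat -> X) :=
  forall e : R, 0 < e ->
    exists (n0 : nat) (p : X), forall n, (n0 <= n)%N -> chain_ball e p (x n).

(* Main.v *)
Require Import Defs.
From HB Require Import structures.
From mathcomp Require Import all_boot all_order all_algebra.
From mathcomp Require Import all_classical all_reals all_analysis.
Set Implicit Arguments.
Unset Strict Implicit.
Unset Printing Implicit Defensive.
Import Order.TTheory GRing.Theory Num.Theory.
Import numFieldNormedType.Exports.
Local Open Scope classical_set_scope.
Local Open Scope ring_scope.


(* (3) => (1): if f is not Lipschitz in the small, there are pairs (x_n, y_n)
   with d(x_n, y_n) < 1/(n+1) and rho(f x_n, f y_n) > (n+1) d(x_n, y_n), so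
   I(x_n) tends to 0.  Along a Bourbaki quasi-Cauchy subsequence, consecutive
   x_n can be joined by chains of ever smaller mesh; inserting the detours
   x_n, y_n, x_n gives one quasi-Cauchy sequence in which every bad pair is
   consecutive, so f is not quasi-Cauchy Lipschitz.
   (2) => (3): if (x_n) has no Bourbaki quasi-Cauchy subsequence, a diagonal
   argument yields e > 0 and an infinite set S of indices of which every class
   of e-chainable points contains finitely many.  On the class of z, let
   f(z) = (m+1) d(x_m, z), where m in S is a fixed index with x_m in that class
   (and m = 0 if there is none).  A quasi-Cauchy sequence eventually stays in
   one class, where f is Lipschitz; but the slopes m+1 are unbounded, and they
   are attained at small distances because I(x_m) tends to 0. *)

Lemma exists_natSinv_lt (R : archiRealFieldType) (e : R) :
  0 < e -> exists j : nat, j.+1%:R^-1 < e.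
Proof.
move=> e0; exists (Num.Def.trunc e^-1).
by rewrite invf_plt ?posrE// truncnS_gt.
Qed.

(** * Chains with small steps, and the degree of isolation *)

Section ChainBall.
Variables (R : realType) (X : metricType R).
Implicit Types (e : R) (p q r : X) (x w : nat -> X).

Lemma chain_ball_refl e p : chain_ball e p p.
Proof. by exists 0%N, (fun=> p). Qed.

Lemma chain_ball_step e p q r :
  chain_ball e p q -> mdist q r < e -> chain_ball e p r.
Proof.
move=> [n [c [c0 cn ce]]] qr.
exists n.+1, (fun i => if (i <= n)%N then c i else r); split=> //=.
  by rewrite ltnn.
move=> i; rewrite ltnS => ile; rewrite ile; case: ltnP => [/ce//|ni].
by have -> : i = n; [apply/eqP; rewrite eqn_leq ile|rewrite cn].
Qed.

Lemma chain_ball_ind e p (P : X -> Prop) : P p ->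
  (forall q r, chain_ball e p q -> P q -> mdist q r < e -> P r) ->
  forall q, chain_ball e p q -> P q.
Proof.
move=> Pp IH q [n [c [c0 cn ce]]].
suff H i : (i <= n)%N -> chain_ball e p (c i) /\ P (c i).
  by have [_] := H n (leqnn n); rewrite cn.
elim: i => [|i IHi] ilen.
  by rewrite c0; split=> //; exact: chain_ball_refl.
have [pci Pci] := IHi (ltnW ilen).
by split; [exact: chain_ball_step pci (ce _ ilen)|exact: IH pci Pci (ce _ ilen)].
Qed.

Lemma chain_ball_trans e p q r :
  chain_ball e p q -> chain_ball e q r -> chain_ball e p r.
Proof.
by move=> pq; apply: (chain_ball_ind pq) => s t _; exact: chain_ball_step.
Qed.

Lemma chain_ball_sym e p q : chain_ball e p q -> chain_ball e q p.
Proof.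
apply: (@chain_ball_ind e p (fun s => chain_ball e s p)) => [|s t _ sp st].
  exact: chain_ball_refl.
apply: chain_ball_trans sp; apply: chain_ball_step (chain_ball_refl _ _) _.
by rewrite metric_sym.
Qed.

Lemma chain_ball_le e1 e2 p q :
  e1 <= e2 -> chain_ball e1 p q -> chain_ball e2 p q.
Proof.
move=> e12 [n [c [c0 cn ce]]]; exists n, c; split=> // i /ce.
by move/lt_le_trans; exact.
Qed.

(** Running through the chains one after another gives [w]: the mesh of chain [k] tends to 0, so [w]
    is quasi-Cauchy, and no step of any chain is lost. *)
Lemma concat_chains (n : nat -> nat) (c : nat -> nat -> X) :
  (forall k, (0 < n k)%N) -> (forall k, c k (n k) = c k.+1 0%N) ->
  (forall e, 0 < e -> exists k0, forall k i, (k0 <= k)%N -> (i < n k)%N ->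
    mdist (c k i) (c k i.+1) < e) ->
  exists2 w, quasi_cauchy w & forall k i, (i < n k)%N ->
    exists t, w t = c k i /\ w t.+1 = c k i.+1.
Proof.
move=> n0 cn small.
(* A state [(k, i)] keeps [i < n k]; the last point of a chain is visited as point 0 of the next
   one. *)
pose next (s : nat * nat) :=
  if (s.2.+1 < n s.1)%N then (s.1, s.2.+1) else (s.1.+1, 0%N).
pose st t := iter t next (0, 0)%N.
pose w t := c (st t).1 (st t).2.
have lt_st t : ((st t).2 < n (st t).1)%N.
  by elim: t => [|t _] /=; [exact: n0|rewrite /next; case: ifP].
have wS t : w t.+1 = c (st t).1 (st t).2.+1.
  rewrite /w /= -/(st t) /next; case: ltnP => //= ge_n.
  by rewrite -cn; congr c; apply/eqP; rewrite eqn_leq ge_n lt_st.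
have le_st t u : (t <= u)%N -> ((st t).1 <= (st u).1)%N.
  move=> /subnK <-; elim: (u - t)%N => // d /leq_trans; apply.
  by rewrite addSn /= -/(st _) /next; case: ifP.
have reach k i : (i < n k)%N -> exists t, st t = (k, i).
  elim: k i => [|k IHk]; elim=> [|i IHi] ilt.
  - by exists 0%N.
  - have [t st_t] := IHi (ltnW ilt).
    by exists t.+1; rewrite /= -/(st t) st_t /next /= ilt.
  - have [|t st_t] := IHk (n k).-1; first by rewrite prednK.
    by exists t.+1; rewrite /= -/(st t) st_t /next /= prednK// ltnn.
  - have [t st_t] := IHi (ltnW ilt).
    by exists t.+1; rewrite /= -/(st t) st_t /next /= ilt.
exists w => [e e0|k i /reach[t st_t]]; last first.
  by exists t; rewrite wS /w st_t.
have [k0 k0e] := small _ e0; have [t0 st0] := reach k0 0%N (n0 k0).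
exists t0 => t /le_st; rewrite st0 => le_k0.
by rewrite metric_sym wS; exact: k0e.
Qed.

Lemma isolation_ge0 p : (0 <= isolation p)%E.
Proof. by apply: le_ereal_inf_tmp => _ [q _ <-]; rewrite lee_fin mdist_ge0. Qed.

Lemma isolation_le p q : p != q -> (isolation p <= (mdist p q)%:E)%E.
Proof.
by move=> /eqP pq; apply: ereal_inf_lbound; exists q => // /esym.
Qed.

Lemma isolation_lt p e : (isolation p < e%:E)%E ->
  exists2 q, q != p & mdist p q < e.
Proof.
move=> /ereal_inf_lt[_ [q qp <-]]; rewrite lte_fin => pq.
by exists q => //; apply/eqP.
Qed.

(* The finitely many ratios of the initial terms are absorbed into the
   Lipschitz constant. *)
Lemma quasi_cauchy_lipschitz_of_tail (Y : metricType R) (f : X -> Y) :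
  (forall w, quasi_cauchy w -> exists l : R, exists n0, forall n, (n0 <= n)%N ->
    mdist (f (w n)) (f (w n.+1)) <= l * mdist (w n) (w n.+1)) ->
  quasi_cauchy_lipschitz f.
Proof.
move=> tail w /tail[l [n0 ln0]].
pose ratio k := mdist (f (w k)) (f (w k.+1)) / mdist (w k) (w k.+1).
have ratio_ge0 k : 0 <= ratio k by rewrite divr_ge0 ?mdist_ge0.
have sum_ge0 (P : pred 'I_n0) : 0 <= \sum_(k < n0 | P k) ratio k.
  exact: sumr_ge0.
exists (1 + `|l| + \sum_(k < n0) ratio k).
  by rewrite -addrA ltr_pwDl// addr_ge0.
move=> k; have [n0k|kn0] := leqP n0 k.
  apply: le_trans (ln0 _ n0k) _; apply: ler_wpM2r; first exact: mdist_ge0.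
  by rewrite (le_trans (ler_norm l))// addrAC lerDr addr_ge0.
have [w0|w0] := eqVneq (w k) (w k.+1).
  by rewrite -w0 !mdistxx mulr0.
rewrite -ler_pdivrMr ?mdist_gt0// -/(ratio k).
rewrite (bigD1 (Ordinal kn0))//= addrCA lerDl.
by rewrite !addr_ge0.
Qed.

End ChainBall.

(** * Diagonal extraction of subsequences *)

Definition unbounded (S : set nat) := forall n, exists2 m, (n <= m)%N & S m.

(** [T j.+1] is an infinite part of [T j] inside one class of chains of mesh [1/(j+1)]; [phi j] is
    taken in [T j], so from [j+1] on the subsequence stays in that class. *)
Lemma bourbaki_subsequence (R : realType) (X : metricType R) (x : nat -> X) :
  (forall e : R, 0 < e -> forall S, unbounded S ->
    exists a, unbounded (S `&` [set n | chain_ball e (x a) (x n)])) ->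
  exists2 phi : nat -> nat,
    increasing_seq phi & bourbaki_quasi_cauchy (x \o phi).
Proof.
move=> cls.
(* [g] and [h] are chosen for all sets, arbitrarily on bounded ones, so that [T] can be defined by
   plain recursion and proved unbounded afterwards. *)
have /choice[g gP] (p : nat * set nat) : exists a, unbounded p.2 ->
    unbounded (p.2 `&` [set n | chain_ball p.1.+1%:R^-1 (x a) (x n)]).
  case: p => [j S] /=.
  have [/(cls _ _ _)H|nS] := pselect (unbounded S); last by exists 0%N.
  have [|a aP] := H (j.+1%:R^-1); first by rewrite invr_gt0.
  by exists a.
have /choice[h hP] (p : set nat * nat) : exists m, unbounded p.1 ->
    (p.2 <= m)%N /\ p.1 m.
  case: p => [S n] /=; have [uS|nS] := pselect (unbounded S); last by exists 0%N.
  by have [m nm Sm] := uS n; exists m.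
pose T := nat_rect (fun=> set nat) setT
  (fun j S => S `&` [set n | chain_ball j.+1%:R^-1 (x (g (j, S))) (x n)]).
pose phi := nat_rect (fun=> nat) (h (T 0%N, 0%N))
  (fun j m => h (T j.+1, m.+1)).
have uT j : unbounded (T j).
  by elim: j => [n|j IH]; [exists n|exact: (gP (j, T j))].
have Tphi j : T j (phi j).
  by case: j => [|j]; [exact: (hP (T 0%N, 0%N) (uT _)).2
    |exact: (hP (T j.+1, (phi j).+1) (uT _)).2].
have subT i j : (i <= j)%N -> T j `<=` T i.
  by move=> /subnK <-; elim: (j - i)%N => // d IH n [/IH].
exists phi.
  by apply/increasing_seqP => j; exact: (hP (T j.+1, (phi j).+1) (uT _)).1.
move=> e /exists_natSinv_lt[j je].
exists j.+1, (x (g (j, T j))) => n jn.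
have [_ /=] := subT _ _ jn _ (Tphi n).
by apply: chain_ball_le; exact: ltW.
Qed.

(** * From Bourbaki quasi-Cauchy subsequences to Lipschitz in the small *)

Lemma lipschitz_in_the_small_of_bourbaki (R : realType) (X Y : metricType R)
    (f : X -> Y) :
  (forall x : nat -> X, isolation (x n) @[n --> \oo] --> 0%E ->
    exists2 phi : nat -> nat,
      increasing_seq phi & bourbaki_quasi_cauchy (x \o phi)) ->
  quasi_cauchy_lipschitz f -> lipschitz_in_the_small f.
Proof.
move=> bqc fqc; apply: contrapT => nf.
have /choice[xy xyP] (n : nat) : exists p : X * X,
    mdist p.1 p.2 < n.+1%:R^-1 /\
    n.+1%:R * mdist p.1 p.2 < mdist (f p.1) (f p.2).
  apply: contrapT => nex; apply: nf; exists n.+1%:R^-1, n.+1%:R; split=> //.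
  move=> x y xy; rewrite leNgt; apply/negP => lt_f.
  by apply: nex; exists (x, y).
pose x n := (xy n).1; pose y n := (xy n).2.
have xDy n : x n != y n.
  apply/eqP => xy_n; have [_] := xyP n.
  by rewrite -/(x n) -/(y n) xy_n !mdistxx mulr0 ltxx.
have [|phi phi_incr phi_bqc] := bqc x.
  apply: (squeeze_cvge _ (cvg_cst 0%E) cvge_harmonic).
  apply: nearW => n /=; rewrite isolation_ge0 /=.
  apply: le_trans (isolation_le (xDy n)) _; rewrite lee_fin.
  by have [/ltW] := xyP n.
have /choice[N NP] (j : nat) : exists b, forall n m, (b <= n)%N -> (b <= m)%N ->
    chain_ball j.+1%:R^-1 (x (phi n)) (x (phi m)).
  have [|b [p bp]] := phi_bqc j.+1%:R^-1; first by rewrite invr_gt0.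
  exists b => n m /bp pn /bp pm.
  exact: chain_ball_trans (chain_ball_sym pn) pm.
(* The sum puts both [psi j] and [psi j.+1] beyond the threshold [N j]; the summand [j] gives
   [j <= k j]. *)
pose psi j := (j + \sum_(i < j.+1) N i)%N.
have psiS j : (psi j <= psi j.+1)%N.
  by rewrite /psi [in leqRHS]big_ord_recr /= leq_add// leq_addr.
have Npsi j : (N j <= psi j)%N by rewrite /psi big_ord_recr /= addnA leq_addl.
pose k j := phi (psi j).
have le_k j : (j <= k j)%N.
  have le_phi n : (n <= phi n)%N.
    elim: n => // n /leq_ltn_trans; apply.
    by have /increasing_seqP := phi_incr; exact.
  by apply: leq_trans (le_phi _); rewrite leq_addr.
have /choice[nc ncP] (j : nat) : exists q : nat * (nat -> X),
    [/\ q.2 0%N = x (k j), q.2 q.1 = x (k j.+1) &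
    forall i, (i < q.1)%N -> mdist (q.2 i) (q.2 i.+1) < j.+1%:R^-1].
  have [n [c ncP]] := NP j _ _ (Npsi j) (leq_trans (Npsi j) (psiS j)).
  by exists (n, c).
have xy_lt j : mdist (x (k j)) (y (k j)) < j.+1%:R^-1.
  have [/lt_le_trans + _] := xyP (k j); apply.
  by rewrite lef_pV2 ?posrE// ler_nat ltnS.
(* Each block runs x, y, x and then along a chain to the next x, so that the
   bad pair (x, y) appears as two consecutive terms. *)
pose c j i := match i with 0 => x (k j) | 1 => y (k j) | i'.+2 => (nc j).2 i' end.
have [||| w qcw wP] := @concat_chains _ _ (fun j => (nc j).1.+2) c => //.
- by move=> j /=; have [] := ncP j.
- move=> e /exists_natSinv_lt[j je]; exists j => m i jm im.
  have me : m.+1%:R^-1 < e.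
    by apply: le_lt_trans je; rewrite lef_pV2 ?posrE// ler_nat ltnS.
  apply: lt_trans me; case: i im => [|[|i]] /= im.
  + exact: xy_lt.
  + by have [-> _ _] := ncP m; rewrite metric_sym.
  + by have [_ _] := ncP m; exact.
have [l l0 lP] := fqc w qcw.
(* The bad pair of block [j] has slope above [(k j).+1], which is at least [j.+1 > l]. *)
pose j := Num.Def.trunc l.
have [t [wt wt1]] := wP j 0%N (ltn0Sn _).
have := lP t; rewrite wt wt1 /= leNgt => /negP; apply.
have [_] := xyP (k j); apply: le_lt_trans.
apply: ler_wpM2r; first exact: mdist_ge0.
by apply: le_trans (ltW (truncnS_gt l)) _; rewrite ler_nat ltnS.
Qed.

(** * From real valued functions to Bourbaki quasi-Cauchy subsequences *)

Lemma bourbaki_of_lipschitz_in_the_small (R : realType) (X : metricType R) :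
  (forall f : X -> R^o,
    quasi_cauchy_lipschitz f -> lipschitz_in_the_small f) ->
  forall x : nat -> X, isolation (x n) @[n --> \oo] --> 0%E ->
    exists2 phi : nat -> nat,
      increasing_seq phi & bourbaki_quasi_cauchy (x \o phi).
Proof.
move=> lits x x0; apply: bourbaki_subsequence => e e0 S uS.
apply: contrapT => /forallNP bnd.
have /choice[b bP] a : exists b, forall m,
    S m -> chain_ball e (x a) (x m) -> (m < b)%N.
  have /existsNP[b nb] := bnd a.
  exists b => m Sm am; rewrite ltnNge; apply/negP => bm.
  by apply: nb; exists m.
pose C z := [set m | S m /\ chain_ball e (x m) z].
have C_chain z z' : chain_ball e z z' -> C z = C z'.
  move=> zz'; apply/seteqP; split=> m [Sm mz]; split=> //.
    exact: chain_ball_trans mz zz'.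
  exact: chain_ball_trans mz (chain_ball_sym zz').
have C_step z z' : mdist z z' < e -> C z = C z'.
  by move=> zz'; apply/C_chain/(chain_ball_step (chain_ball_refl _ _) zz').
(* [xget] depends only on the set [C z], so [m] is constant on each class of chainable points. *)
pose m z := xget 0%N (C z).
have mP n : S n -> C (x n) (m (x n)).
  by move=> Sn; apply: xgetPex; exists n; split=> //; exact: chain_ball_refl.
pose f z : R^o := (m z).+1%:R * mdist (x (m z)) z.
have distE (u v : R) : @mdist R R^o u v = `|v - u| by [].
have f_step z z' : mdist z z' < e ->
    mdist (f z) (f z') <= (m z).+1%:R * mdist z z'.
  move=> zz'; have mz : m z' = m z by rewrite /m (C_step _ _ zz').
  rewrite distE /f mz -mulrBr normrM ger0_norm//.
  rewrite ler_pM2l// ler_norml lerBlDr lerNl opprB lerBlDr.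
  rewrite [in X in X && _]addrC [in X in _ && X]addrC metric_triangle.
  by rewrite [mdist z z']metric_sym metric_triangle.
have [|d [K [d0 K0 fK]]] := lits f.
  apply: quasi_cauchy_lipschitz_of_tail => w /(_ e e0)[n0 wn0].
  have Cw n : (n0 <= n)%N -> m (w n) = m (w n0).
    move=> /subnK <-; elim: (n - n0)%N => // i IH.
    by rewrite /m (C_step _ _ (wn0 _ (leq_addl _ _))).
  exists (m (w n0)).+1%:R, n0 => n n0n; rewrite -(Cw _ n0n).
  by apply: f_step; rewrite metric_sym wn0.
(* Below [d] the Lipschitz bound applies; below [e] a neighbour stays in the same class. *)
have near0 : nbhs 0%E [set y : \bar R | (y < (Num.min d e)%:E)%E].
  apply: open_nbhs_nbhs; split; first exact: open_ereal_lt_ereal.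
  by rewrite /= lte_fin lt_min d0.
have [n1 _ n1P] := x0 _ near0.
pose M := maxn n1 (Num.Def.trunc K).
(* [n] exceeds [b i] for every [i < M], so the class of [x n] contains no [x i] with [i] in [S] and
   [i < M]; hence [M <= a]. *)
have [n Mn Sn] := uS (\sum_(i < M) b i)%N.
have [Sm mn] := mP _ Sn; set a := m (x n) in Sm mn.
have Ma : (M <= a)%N.
  rewrite leqNgt; apply/negP => aM.
  have := bP a n Sn mn; rewrite ltnNge => /negP; apply.
  by apply: leq_trans Mn; rewrite (bigD1 (Ordinal aM))//= leq_addr.
have ma : m (x a) = a by rewrite /m (C_chain _ _ mn).
have [|q qa] := @isolation_lt _ _ (x a) (Num.min d e).
  by apply: n1P; rewrite /=; apply: leq_trans Ma; exact: leq_maxl.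
rewrite lt_min => /andP[aqd aqe].
have := fK _ _ aqd; rewrite leNgt => /negP; apply.
have mq : m q = a by rewrite /m -(C_step _ _ aqe).
rewrite distE /f ma mq mdistxx mulr0 subr0.
rewrite normrM ger0_norm// ger0_norm ?mdist_ge0// ltr_pM2r.
  apply: lt_le_trans (truncnS_gt K) _; rewrite ler_nat ltnS.
  by apply: leq_trans Ma; exact: leq_maxr.
by rewrite mdist_gt0 eq_sym.
Qed.

Theorem theorem4p4 (R : realType) (X : metricType R) :
  [<->
    (* (1) *)
    forall (Y : metricType R) (f : X -> Y),
      quasi_cauchy_lipschitz f -> lipschitz_in_the_small f;
    (* (2) *)
    forall f : X -> R^o,
      quasi_cauchy_lipschitz f -> lipschitz_in_the_small f;
    (* (3) *)
    forall x : nat -> X, isolation (x n) @[n --> \oo] --> 0%E ->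
      exists2 phi : nat -> nat,
        increasing_seq phi & bourbaki_quasi_cauchy (x \o phi)].
Proof.
tfae=> [H f|H|H Y f]; first exact: H.
  exact: bourbaki_of_lipschitz_in_the_small.
exact: lipschitz_in_the_small_of_bourbaki.
Qed.
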